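(* Let $\mathbb{V}=U\oplus W$ be an $n$-dimensional vector space over a finite field $\mathcal{F}$ with $q$ elements, where $U,W$ are nonzero subspaces with $\dim U=r$, $\dim W=s$, $r+s=n\ge 2$. Then the order of the direct sum graph $\Gamma_{U\oplus W}(\mathbb{V})$ is $(q^r-1)(q^s-1)$ and its size (number of edges) is $$\frac{\big(q^{2r}-(2q-1)^r\big)\big(q^{2s}-(2q-1)^s\big)-(q^r-1)(q^s-1)}{2}.$$
   Context: Fix a basis $\{\alpha_1,\dots,\alpha_r\}$ of $U$ and a basis $\{\beta_1,\dots,\beta_s\}$ of $W$; every $x\in\mathbb{V}$ is written uniquely as $x=\sum_i a_i\alpha_i+\sum_j b_j\beta_j$. The direct sum graph $\Gamma_{U\oplus W}(\mathbb{V})$ is the simple graph whose vertex set is $\{x=u+w: u\in U, w\in W, u\neq 0, w\neq 0\}$, in which two distinct vertices $x,y$ are adjacent iff there is an index $i$ such that the coefficient of $\alpha_i$ is nonzero in both $x$ and $y$, and there is an index $j$ such that the coefficient of $\beta_j$ is nonzero in both $x$ and $y$. *)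

(* Defs.v *)
From HB Require Import structures.
From mathcomp Require Import all_boot all_order all_algebra all_field.

Set Implicit Arguments.
Unset Strict Implicit.
Unset Printing Implicit Defensive.

Import GRing.Theory.
Local Open Scope ring_scope.

(* Only the restriction of [adj] to [verts] is meaningful. *)
Record simple_graph (T : finType) := SimpleGraph {
  verts : {set T};
  adj : rel T;
  adj_sym : symmetric adj;
  adj_irr : irreflexive adj
}.

Definition edges (T : finType) (G : simple_graph T) : {set {set T}} :=
  [set [set x; y] | x in verts G, y in verts G & adj G x y].

Definition graph_order (T : finType) (G : simple_graph T) : nat := #|verts G|.

Definition graph_size (T : finType) (G : simple_graph T) : nat := #|edges G|.

Section DirectSumGraph.

(* [finvect_type vT] is [vT] itself, with its finite type structure. *)
Variables (F : finFieldType) (vT : vectType F) (U W : {vspace vT}).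
Variables (r s : nat) (alpha : r.-tuple vT) (beta : s.-tuple vT).

Implicit Types x y u w : finvect_type vT.

(* The coefficients of x in the concatenated basis (alpha, beta) of vT. *)
Definition coefU (i : 'I_r) x : F := coord [tuple of alpha ++ beta] (lshift s i) x.
Definition coefW (j : 'I_s) x : F := coord [tuple of alpha ++ beta] (rshift r j) x.

Definition ds_verts : {set finvect_type vT} :=
  [set x : finvect_type vT |
     [exists u : finvect_type vT, exists w : finvect_type vT,
     [&& (u : vT) \in U, (w : vT) \in W, u != 0, w != 0 & x == u + w]]].

Definition ds_adj : rel (finvect_type vT) := fun x y =>
  [&& x != y,
      [exists i, (coefU i x != 0) && (coefU i y != 0)] &
      [exists j, (coefW j x != 0) && (coefW j y != 0)]].

Lemma ds_adj_sym : symmetric ds_adj.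
Proof.
move=> x y; rewrite /ds_adj eq_sym.
by congr [&& _, _ & _]; apply: eq_existsb => i; rewrite andbC.
Qed.

Lemma ds_adj_irr : irreflexive ds_adj.
Proof. by move=> x; rewrite /ds_adj eqxx. Qed.

Definition direct_sum_graph : simple_graph (finvect_type vT) :=
  SimpleGraph ds_verts ds_adj_sym ds_adj_irr.

End DirectSumGraph.

(* Main.v *)
(* Taking coordinates identifies [vT] with [F^r * F^s], and a vector is a vertex
   iff both of its components are nonzero. Pairs in [F^r * F^r] with disjoint
   supports are chosen coordinatewise among the [2q - 1] pairs [(a, b)] with
   [a = 0] or [b = 0], so [q^(2r) - (2q-1)^r] pairs have meeting supports. The
   pairs [(x, y)] of vectors whose supports meet on both sides are therefore
   counted by a product; they are the arcs of the graph together with the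
   diagonal of the vertex set, and each edge carries two arcs. *)

Require Import Defs.
From HB Require Import structures.
From mathcomp Require Import all_boot all_order all_algebra all_field.

Set Implicit Arguments.
Unset Strict Implicit.
Unset Printing Implicit Defensive.

Import GRing.Theory.
Local Open Scope ring_scope.


Definition arcs (T : finType) (G : simple_graph T) : {set T * T} :=
  [set p | [&& p.1 \in verts G, p.2 \in verts G & adj G p.1 p.2]].

(** The arcs are fibred over the edges by forgetting the order of the ends. The fibre over the edge
    of an arc [(x, y)] consists of [(x, y)] and [(y, x)], which differ because adjacency is
    irreflexive. *)
Lemma card_arcs (T : finType) (G : simple_graph T) :
  #|arcs G| = (graph_size G * 2)%N.
Proof.
pose ends (p : T * T) := [set p.1; p.2].
have edgesE : edges G = ends @: arcs G.
  apply/setP=> e; apply/imset2P/imsetP => [[x y xV]|[[x y]]].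
    by rewrite inE => /andP[yV xy] ->; exists (x, y); rewrite // inE /= xV yV.
  rewrite inE /= => /and3P[xV yV xy] ->.
  by apply: Imset2spec xV _ erefl; rewrite inE yV.
rewrite /graph_size edgesE -sum1_card (partition_big_imset ends) /=.
rewrite -sum_nat_const; apply: eq_bigr => e /imsetP[[x y] xyA ->{e}].
rewrite sum1dep_card; move: (xyA); rewrite inE /= => /and3P[xV yV xy].
have neq_xy : x != y by apply: contraTneq xy => ->; rewrite adj_irr.
have -> : [set p | (p \in arcs G) && (ends p == ends (x, y))]
          = [set (x, y); (y, x)].
  apply/setP=> -[a b]; rewrite !inE /= !xpair_eqE.
  apply/andP/orP => [[/and3P[_ _ ab] /eqP eq_ends]|].
    have neq_ab : a != b by apply: contraTneq ab => ->; rewrite adj_irr.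
    (* Both [a] and [b] lie in the set of [x] and [y]. Of the four cases, two contradict [a != b]
       and the other two are the listed pairs. *)
    have := set21 a b; have := set22 a b; move: neq_ab.
    rewrite -[[set a; b]]/(ends (a, b)) eq_ends => /[swap].
    by move=> /set2P[]-> /[swap] /set2P[]->; rewrite !eqxx //; [right|left].
  case=> /andP[/eqP-> /eqP->]; rewrite ?xV ?yV ?[adj G y x]adj_sym xy //=.
  by split=> //; apply/eqP; rewrite /ends /= setUC.
by rewrite cards2 xpair_eqE (negPf neq_xy).
Qed.

Section MeetingSupports.

Variables (F : finFieldType) (I : finType).

Definition supports_meet (p : {ffun I -> F} * {ffun I -> F}) : bool :=
  [exists i, (p.1 i != 0) && (p.2 i != 0)].

(** The two axes of the plane [F * F] have [#|F|] points each and share only the origin. *)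
Lemma card_pairs_with_zero :
  #|[pred a : F * F | (a.1 == 0) || (a.2 == 0)]| = (#|F| * 2).-1%N.
Proof.
have -> : #|[pred a : F * F | (a.1 == 0) || (a.2 == 0)]|
          = #|setX [set 0 : F] [set: F] :|: setX [set: F] [set 0 : F]|.
  by apply: eq_card => -[a b]; rewrite !inE /= andbT.
rewrite cardsU !cardsX.
have -> : setX [set 0 : F] setT :&: setX setT [set 0 : F] = [set (0 : F, 0 : F)].
  by apply/setP=> -[a b]; rewrite !inE /= xpair_eqE andbT.
by rewrite !cards1 cardsT mul1n muln1 muln2 addnn subn1.
Qed.

(** A pair of functions is the same as one function into pairs ([zip], [unzip]). Supports are
    disjoint iff every value of that function lies on an axis. *)
Lemma card_supports_disjoint :
  #|[set p | ~~ supports_meet p]| = ((#|F| * 2).-1 ^ #|I|)%N.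
Proof.
pose D := [pred a : F * F | (a.1 == 0) || (a.2 == 0)].
pose unzip (h : {ffun I -> F * F}) :=
  ([ffun i => (h i).1], [ffun i => (h i).2]).
pose zip (p : {ffun I -> F} * {ffun I -> F}) := [ffun i => (p.1 i, p.2 i)].
have zipK : cancel zip unzip.
  by case=> f g; congr (_, _); apply/ffunP=> i; rewrite !ffunE.
have unzipK : cancel unzip zip.
  by move=> h; apply/ffunP=> i; rewrite !ffunE; case: (h i).
rewrite -card_pairs_with_zero -card_ffun_on.
have -> : [set p | ~~ supports_meet p] = zip @^-1: [set h in ffun_on D].
  apply/setP=> p; rewrite !inE negb_exists; apply: eq_forallb => i.
  by rewrite ffunE inE /= negb_and !negbK.
rewrite on_card_preimset; last by exists unzip => h _; [apply: zipK|apply: unzipK].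
by rewrite cardsE.
Qed.

Lemma card_supports_meet (R : pzRingType) :
  #|[set p | supports_meet p]|%:R
  = (#|F|%:R ^+ (2 * #|I|) - (2 * #|F|%:R - 1) ^+ #|I|) :> R.
Proof.
(* Positivity makes the truncated predecessor agree with the subtraction of 1 in [R]. *)
have F_gt0 : (0 < #|F| * 2)%N by rewrite muln_gt0 (cardD1 0).
apply/(canRL (addrK _)).
have -> : 2 * #|F|%:R - 1 = (#|F| * 2).-1%N%:R :> R.
  by rewrite -subn1 natrB // [in RHS]mulnC natrM.
rewrite -!natrX -natrD -card_supports_disjoint; congr (_%:R).
have -> : [set p | ~~ supports_meet p] = ~: [set p | supports_meet p].
  by apply/setP=> p; rewrite !inE.
by rewrite cardsC card_prod card_ffun mulnC expnM -mulnn.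
Qed.

Lemma supports_meet_diag (f : {ffun I -> F}) : supports_meet (f, f) = (f != 0).
Proof.
apply/existsP/idP => /= [[i]|nz_f].
  by rewrite andbb; apply: contraNneq => ->; rewrite ffunE.
apply/existsP; apply: contraNT nz_f; rewrite negb_exists => /forallP f0.
by apply/eqP/ffunP=> i; have := f0 i; rewrite andbb negbK ffunE => /eqP.
Qed.

(** This makes the ends of a pair whose supports meet on both sides vertices automatically. *)
Lemma supports_meet_neq0 (f g : {ffun I -> F}) :
  supports_meet (f, g) -> (f != 0) && (g != 0).
Proof.
case/existsP=> i /= /andP[fi gi].
by apply/andP; split; [move: fi|move: gi]; apply: contraNneq => ->; rewrite ffunE.
Qed.

End MeetingSupports.

Lemma card_neq0_ffun (R : pzRingType) (F : finFieldType) (I : finType) :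
  #|[set~ (0 : {ffun I -> F})]|%:R = #|F|%:R ^+ #|I| - 1 :> R.
Proof.
have := cardsC1 (0 : {ffun I -> F}); rewrite card_ffun => ->.
by rewrite -subn1 natrB ?natrX // expn_gt0 (cardD1 0).
Qed.

Section Coefficients.

Variables (F : finFieldType) (vT : vectType F) (U W : {vspace vT}).
Variables (r s : nat) (alpha : r.-tuple vT) (beta : s.-tuple vT).
Hypotheses (sum_UW : (U + W)%VS = fullv) (direct_UW : directv (U + W)).
Hypotheses (basis_U : basis_of U alpha) (basis_W : basis_of W beta).

Local Notation coeff_space := ({ffun 'I_r -> F} * {ffun 'I_s -> F})%type.

Definition coeffs (x : finvect_type vT) : coeff_space :=
  ([ffun i => coefU alpha beta i x], [ffun j => coefW alpha beta j x]).

Arguments coeffs : simpl never.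

Definition of_coeffs (c : coeff_space) : finvect_type vT :=
  \sum_i c.1 i *: alpha`_i + \sum_j c.2 j *: beta`_j.

Lemma basis_cat : basis_of fullv [tuple of alpha ++ beta].
Proof. by rewrite -sum_UW; apply: cat_basis. Qed.

Lemma sum_cat_basis (k : 'I_(r + s) -> F) :
  \sum_i k i *: [tuple of alpha ++ beta]`_i
  = \sum_i k (lshift s i) *: alpha`_i + \sum_j k (rshift r j) *: beta`_j.
Proof.
rewrite big_split_ord /=; congr (_ + _); apply: eq_bigr => i _.
  by rewrite nth_cat size_tuple ltn_ord.
by rewrite nth_cat size_tuple ltnNge leq_addr /= addKn.
Qed.

Lemma coeffsK : cancel coeffs of_coeffs.
Proof.
move=> x; rewrite [RHS](coord_basis basis_cat (memvf _)) sum_cat_basis.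
by congr (_ + _); apply: eq_bigr => i _; rewrite ffunE.
Qed.

Lemma of_coeffsK : cancel of_coeffs coeffs.
Proof.
move=> [f g].
(* The two families are glued into one over the concatenated basis, whose freeness then recovers
   each coefficient. *)
pose k (i : 'I_(r + s)) := match split i with inl a => f a | inr b => g b end.
have kl a : k (lshift s a) = f a by rewrite /k (unsplitK (inl a)).
have kr b : k (rshift r b) = g b by rewrite /k (unsplitK (inr b)).
have -> : of_coeffs (f, g) = \sum_i k i *: [tuple of alpha ++ beta]`_i.
  rewrite sum_cat_basis.
  by congr (_ + _); apply: eq_bigr => i _; rewrite ?kl ?kr.
have free_cat := basis_free basis_cat.
congr (_, _); apply/ffunP=> i; rewrite ffunE.
  by rewrite /coefU coord_sum_free.
by rewrite /coefW coord_sum_free.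
Qed.

Lemma coeffs_bij : bijective coeffs.
Proof. by exists of_coeffs; [apply: coeffsK|apply: of_coeffsK]. Qed.

Lemma lincomb_eq0 (m : nat) (X : m.-tuple vT) (f : {ffun 'I_m -> F}) :
  free X -> (\sum_i f i *: X`_i == 0) = (f == 0).
Proof.
move=> freeX; apply/eqP/eqP => [f0|->].
  by apply/ffunP=> i; rewrite ffunE -(coord_sum_free f i freeX) f0 linear0.
by apply: big1 => i _; rewrite ffunE scale0r.
Qed.

Lemma lincomb_mem (m : nat) (X : m.-tuple vT) (V : {vspace vT}) (f : 'I_m -> F) :
  basis_of V X -> \sum_i f i *: X`_i \in V.
Proof.
move=> basisX; apply: memv_suml => i _.
by rewrite memvZ // (basis_mem basisX) // mem_nth // size_tuple.
Qed.

(** Vertices are defined through [U] and [W] alone, adjacency through coordinates. The two meet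
    here: expanding [u] in [alpha] and [w] in [beta] gives the coordinates of [u + w], and by
    freeness a component vanishes iff all its coefficients do. *)
Lemma ds_vertsE :
  ds_verts U W = coeffs @^-1:
  setX [set~ (0 : {ffun 'I_r -> F})] [set~ (0 : {ffun 'I_s -> F})].
Proof.
apply/setP=> x; rewrite !inE.
have freeU := basis_free basis_U; have freeW := basis_free basis_W.
apply/existsP/andP => [[u /existsP[w /and5P[uU wW u0 w0 /eqP->]]]|[f0 g0]].
  pose f := [ffun i => coord alpha i u]; pose g := [ffun j => coord beta j w].
  have uE : u = \sum_i f i *: alpha`_i.
    rewrite [LHS](coord_basis basis_U uU).
    by apply: eq_bigr => i _; rewrite ffunE.
  have wE : w = \sum_j g j *: beta`_j.
    rewrite [LHS](coord_basis basis_W wW).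
    by apply: eq_bigr => i _; rewrite ffunE.
  have -> : u + w = of_coeffs (f, g) by rewrite uE wE.
  rewrite of_coeffsK /=.
  by rewrite -(lincomb_eq0 _ freeU) -uE -(lincomb_eq0 _ freeW) -wE.
(* The witnesses are the two halves of the expansion of [x] in the concatenated basis. *)
exists (\sum_i (coeffs x).1 i *: alpha`_i).
apply/existsP; exists (\sum_j (coeffs x).2 j *: beta`_j).
apply/and5P; split; first exact: lincomb_mem.
- exact: lincomb_mem.
- by rewrite (lincomb_eq0 _ freeU).
- by rewrite (lincomb_eq0 _ freeW).
by apply/eqP; rewrite -[LHS]coeffsK.
Qed.

Lemma ds_adjE x y :
  ds_adj alpha beta x y =
  [&& x != y, supports_meet ((coeffs x).1, (coeffs y).1)
            & supports_meet ((coeffs x).2, (coeffs y).2)].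
Proof.
by congr [&& _, _ & _]; apply: eq_existsb => i; rewrite /= !ffunE.
Qed.

Lemma card_ds_verts :
  #|ds_verts U W|
  = (#|[set~ (0%R : {ffun 'I_r -> F})]| * #|[set~ (0%R : {ffun 'I_s -> F})]|)%N.
Proof.
by rewrite ds_vertsE on_card_preimset ?cardsX //; apply/onW_bij/coeffs_bij.
Qed.

Lemma card_ds_arcs :
  (#|arcs (direct_sum_graph U W alpha beta)| + #|ds_verts U W|
   = #|[set p | @supports_meet F 'I_r p]| * #|[set p | @supports_meet F 'I_s p]|)%N.
Proof.
(* Regrouping two coefficient vectors by side rather than by vector turns the joint condition into a
   cartesian product. *)
pose both (p : finvect_type vT * finvect_type vT) :=
  (((coeffs p.1).1, (coeffs p.2).1), ((coeffs p.1).2, (coeffs p.2).2)).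
have both_bij : bijective both.
  exists (fun c => (of_coeffs (c.1.1, c.2.1), of_coeffs (c.1.2, c.2.2))).
    by case=> x y; congr (_, _); apply: coeffsK.
  by case=> -[f f'] [g g']; rewrite /both !of_coeffsK.
rewrite -cardsX -(on_card_preimset (onW_bij _ both_bij)).
set B := both @^-1: _.
have memB x y : ((x, y) \in B) = supports_meet ((coeffs x).1, (coeffs y).1)
                                 && supports_meet ((coeffs x).2, (coeffs y).2).
  by rewrite !inE.
have memV x : (x \in ds_verts U W) = ((coeffs x).1 != 0) && ((coeffs x).2 != 0).
  by rewrite ds_vertsE !inE.
pose diag := [set p : finvect_type vT * finvect_type vT | p.1 == p.2].
(* On the diagonal, meeting supports just means nonzero components, which gives the vertices. Off
   the diagonal lie the arcs. *)
rewrite -(cardsID diag B) addnC; congr (_ + _)%N.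
  have -> : B :&: diag = [set (x, x) | x in ds_verts U W].
    apply/setP=> -[x y]; rewrite inE memB [(x, y) \in diag]inE /=.
    apply/andP/imsetP => [[/[swap] /eqP<-]|[z + [-> ->]]].
      by rewrite !supports_meet_diag => xV; exists x; rewrite // memV.
    by rewrite memV !supports_meet_diag.
  by rewrite card_imset // => x y [].
apply: eq_card => -[x y]; rewrite in_setD [(x, y) \in diag]inE memB.
rewrite [LHS]inE /= ds_adjE !memV.
apply/and3P/and3P => [[_ _ /and3P[]]|[neq_xy meetU meetW]] //.
have /andP[xU yU] := supports_meet_neq0 meetU.
have /andP[xW yW] := supports_meet_neq0 meetW.
by rewrite xU xW yU yW neq_xy meetU meetW.
Qed.

End Coefficients.

Theorem theorem3p4 (F : finFieldType) (vT : vectType F) (U W : {vspace vT})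
    (q r s n : nat) (alpha : r.-tuple vT) (beta : s.-tuple vT)
    (card_F : #|F| = q)
    (dim_V : \dim {: vT} = n)
    (sum_UW : (U + W)%VS = fullv) (direct_UW : directv (U + W))
    (U_neq0 : U != 0%VS) (W_neq0 : W != 0%VS)
    (dim_U : \dim U = r) (dim_W : \dim W = s)
    (dim_rs : (r + s)%N = n) (n_ge2 : (2 <= n)%N)
    (basis_U : basis_of U alpha) (basis_W : basis_of W beta) :
  let G := direct_sum_graph U W alpha beta in
  let Q : rat := q%:R in
  (graph_order G)%:R = (Q ^+ r - 1) * (Q ^+ s - 1) :> rat /\
  (graph_size G)%:R =
    ((Q ^+ (2 * r) - (2 * Q - 1) ^+ r) * (Q ^+ (2 * s) - (2 * Q - 1) ^+ s)
     - (Q ^+ r - 1) * (Q ^+ s - 1)) / 2 :> rat.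
Proof.
move=> G Q; have orderE : (graph_order G)%:R = (Q ^+ r - 1) * (Q ^+ s - 1) :> rat.
  rewrite /graph_order (card_ds_verts sum_UW direct_UW basis_U basis_W) natrM.
  by rewrite !card_neq0_ffun !card_ord card_F.
(* Clearing the division by 2 and the subtracted order leaves twice the size plus the order on the
   left, which is the count in [card_ds_arcs]. *)
split=> //; apply: (canRL (mulfK _)) => //; apply: (canRL (addrK _)).
rewrite -orderE -natrM -card_arcs -natrD.
rewrite (card_ds_arcs sum_UW direct_UW basis_U basis_W) natrM.
by rewrite !card_supports_meet !card_ord card_F.
Qed.
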